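(* Let $\tau_{V_W},\tau_{V_L},\tau_{\psi_W},\tau_{\psi_L}>0$, $V_n>0$, $x_r,y_r\in\mathbb{R}$, and let $K_{xp},K_{xI},K_x,K_V,K_{yp},K_{yI},K_y,K_\psi\in\mathbb{R}$ be control gains. Consider the linear system $$\dot{\mathbf{x}}(t)=A\mathbf{x}(t)+B\mathbf{u}(t)+E\mathbf{d}(t),$$ with state $\mathbf{x}=[x\ V_W\ V_L\ y\ \psi_W\ \psi_L]^T$, control input $\mathbf{u}=[V_{W_c}\ \psi_{W_c}]^T$ and exogenous input $\mathbf{d}=[V_{L_c}\ \psi_{L_c}]^T$, given componentwise by $$\begin{aligned} \dot{x}&=V_L-V_W+\tfrac{y_r}{\tau_{\psi_W}}\psi_W-\tfrac{y_r}{\tau_{\psi_W}}\psi_{W_c},\\ \dot{V}_W&=-\tfrac{1}{\tau_{V_W}}V_W+\tfrac{1}{\tau_{V_W}}V_{W_c},\\ \dot{V}_L&=-\tfrac{1}{\tau_{V_L}}V_L+\tfrac{1}{\tau_{V_L}}V_{L_c},\\ \dot{y}&=-V_n\psi_L+\big(V_n-\tfrac{x_r}{\tau_{\psi_W}}\big)\psi_W+\tfrac{x_r}{\tau_{\psi_W}}\psi_{W_c},\\ \dot{\psi}_W&=-\tfrac{1}{\tau_{\psi_W}}\psi_W+\tfrac{1}{\tau_{\psi_W}}\psi_{W_c},\\ \dot{\psi}_L&=-\tfrac{1}{\tau_{\psi_L}}\psi_L+\tfrac{1}{\tau_{\psi_L}}\psi_{L_c}, \end{aligned}$$ with the control inputs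 given by the proportional-integral laws $$V_{W_c}=K_{xp}e_x+K_{xI}\int_0^t e_x\,dt,\qquad e_x=K_x x+K_V(V_L-V_W),$$ $$\psi_{W_c}=K_{yp}e_y+K_{yI}\int_0^t e_y\,dt,\qquad e_y=K_y y+K_\psi(\psi_L-\psi_W).$$ Suppose that the gains in the $x$-channel satisfy $$K_{xp}K_V+1>0,\qquad K_xK_{xI}>0,\qquad K_{xp}K_x+K_VK_{xI}>\frac{\tau_{V_W}K_xK_{xI}}{K_{xp}K_V+1},$$ and that the gains in the $y$-channel satisfy $$K_{yp}K_\psi-x_rK_yK_{yp}+1>0,\qquad K_yK_{yI}<0,$$ $$K_{yI}K_\psi-K_y\big(V_nK_{yp}+x_rK_{yI}\big)>-\frac{\tau_{\psi_W}V_nK_yK_{yI}}{K_{yp}K_\psi-x_rK_yK_{yp}+1}.$$ Then the closed-loop system is stable: with the state augmented by the two integrator states $z_x=\int_0^t e_x\,dt$ and $z_y=\int_0^t e_y\,dt$, all eigenvalues of the resulting $8\times 8$ closed-loop system matrix (the matrix $M$ in $\dot{\boldsymbol{\xi}}=M\boldsymbol{\xi}+N\mathbf{d}$, where $\boldsymbol{\xi}=[\mathbf{x}^T\ z_x\ z_y]^T$) have strictly negative real part.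
   Context: The system is the linearized error dynamics of a leader-wingman flight formation. The variables $x,y$ are the deviations of the longitudinal and lateral separations from their desired constant values $x_r,y_r$. The variables $V_L,V_W$ are the deviations of the leader and wingman speeds from the nominal speed $V_n$, and $\psi_L,\psi_W$ are the leader and wingman headings. The constants $\tau_{V_W},\tau_{V_L},\tau_{\psi_W},\tau_{\psi_L}>0$ are the time constants of the speed and heading autopilots. The leader commands $V_{L_c},\psi_{L_c}$ are external (exogenous) inputs, and $V_{W_c},\psi_{W_c}$ are the wingman commands. The integrator states satisfy $\dot z_x=e_x$ and $\dot z_y=e_y$, so that $V_{W_c}=K_{xp}e_x+K_{xI}z_x$ and $\psi_{W_c}=K_{yp}e_y+K_{yI}z_y$. The matrices $A,B,E$ are the constant matrices determined by the componentwise equations in the claim. *)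

(* Defs.v *)
From mathcomp Require Import all_boot all_order all_algebra.
From mathcomp Require Import all_classical all_reals all_analysis.
From mathcomp Require Import complex ring.
Import Order.TTheory GRing.Theory Num.Theory numFieldNormedType.Exports.

Set Implicit Arguments.
Unset Strict Implicit.
Unset Printing Implicit Defensive.

Local Open Scope classical_set_scope.
Local Open Scope ring_scope.

Record plant (R : Type) := Plant {
  tau_VW : R;
  tau_VL : R;
  tau_psiW : R;
  tau_psiL : R;
  Vn : R;
  xr : R;
  yr : R }.

Record gains (R : Type) := Gains {
  Kxp : R;
  KxI : R;
  Kx : R;
  KV : R;
  Kyp : R;
  KyI : R;
  Ky : R;
  Kpsi : R }.

Definition colv (R : realType) (n : nat) (s : seq R) : 'cV[R]_n :=
  \col_(i < n) s`_i.

Definition mx_of_rows (R : realType) (m n : nat) (s : seq (seq R)) :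
    'M[R]_(m, n) :=
  \matrix_(i < m, j < n) (nth [::] s i)`_j.

(* Vectors are ordered as x = [x V_W V_L y psi_W psi_L]^T,
   u = [V_Wc psi_Wc]^T, d = [V_Lc psi_Lc]^T. *)

Definition plant_rhs (R : realType) (p : plant R)
    (x V_W V_L y psi_W psi_L V_Wc psi_Wc V_Lc psi_Lc : R) : 'cV[R]_6 :=
  colv 6 [::
    V_L - V_W + yr p / tau_psiW p * psi_W - yr p / tau_psiW p * psi_Wc;
    - (1 / tau_VW p) * V_W + 1 / tau_VW p * V_Wc;
    - (1 / tau_VL p) * V_L + 1 / tau_VL p * V_Lc;
    - Vn p * psi_L + (Vn p - xr p / tau_psiW p) * psi_W
      + xr p / tau_psiW p * psi_Wc;
    - (1 / tau_psiW p) * psi_W + 1 / tau_psiW p * psi_Wc;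
    - (1 / tau_psiL p) * psi_L + 1 / tau_psiL p * psi_Lc].

Definition plant_A (R : realType) (p : plant R) : 'M[R]_6 :=
  mx_of_rows 6 6 [::
    [:: 0; -1;               1;                0; yr p / tau_psiW p;        0];
    [:: 0; - (1 / tau_VW p); 0;                0; 0;                        0];
    [:: 0; 0;                - (1 / tau_VL p); 0; 0;                        0];
    [:: 0; 0;                0;                0; Vn p - xr p / tau_psiW p; - Vn p];
    [:: 0; 0;                0;                0; - (1 / tau_psiW p);       0];
    [:: 0; 0;                0;                0; 0;       - (1 / tau_psiL p)]].

Definition plant_B (R : realType) (p : plant R) : 'M[R]_(6, 2) :=
  mx_of_rows 6 2 [::
    [:: 0;            - (yr p / tau_psiW p)];
    [:: 1 / tau_VW p; 0];
    [:: 0;            0];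
    [:: 0;            xr p / tau_psiW p];
    [:: 0;            1 / tau_psiW p];
    [:: 0;            0]].

Definition plant_E (R : realType) (p : plant R) : 'M[R]_(6, 2) :=
  mx_of_rows 6 2 [::
    [:: 0;            0];
    [:: 0;            0];
    [:: 1 / tau_VL p; 0];
    [:: 0;            0];
    [:: 0;            0];
    [:: 0;            1 / tau_psiL p]].

Lemma plant_rhsE (R : realType) (p : plant R)
    (x V_W V_L y psi_W psi_L V_Wc psi_Wc V_Lc psi_Lc : R) :
  plant_rhs p x V_W V_L y psi_W psi_L V_Wc psi_Wc V_Lc psi_Lc
  = plant_A p *m colv 6 [:: x; V_W; V_L; y; psi_W; psi_L]
    + plant_B p *m colv 2 [:: V_Wc; psi_Wc]
    + plant_E p *m colv 2 [:: V_Lc; psi_Lc].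
Proof.
apply/matrixP => i j; rewrite !mxE !big_ord_recl !big_ord0 !mxE /=.
by case: i => -[|[|[|[|[|[|//]]]]]] ? /=; ring.
Qed.

Definition err_x (R : realType) (k : gains R) (x V_W V_L : R) : R :=
  Kx k * x + KV k * (V_L - V_W).

Definition err_y (R : realType) (k : gains R) (y psi_W psi_L : R) : R :=
  Ky k * y + Kpsi k * (psi_L - psi_W).

Definition err_C (R : realType) (k : gains R) : 'M[R]_(2, 6) :=
  mx_of_rows 2 6 [::
    [:: Kx k; - KV k; KV k; 0;    0;        0];
    [:: 0;    0;      0;    Ky k; - Kpsi k; Kpsi k]].

Lemma err_CE (R : realType) (k : gains R) (x V_W V_L y psi_W psi_L : R) :
  colv 2 [:: err_x k x V_W V_L; err_y k y psi_W psi_L]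
  = err_C k *m colv 6 [:: x; V_W; V_L; y; psi_W; psi_L].
Proof.
apply/matrixP => i j; rewrite !mxE !big_ord_recl !big_ord0 !mxE /=.
by case: i => -[|[|//]] ? /=; rewrite /err_x /err_y; ring.
Qed.

Definition gain_P (R : realType) (k : gains R) : 'M[R]_2 :=
  diag_mx (\row_(i < 2) [:: Kxp k; Kyp k]`_i).

Definition gain_I (R : realType) (k : gains R) : 'M[R]_2 :=
  diag_mx (\row_(i < 2) [:: KxI k; KyI k]`_i).

(* With z = [z_x z_y]^T, z' = C x and u = K_P C x + K_I z, the augmented state
   xi = [x^T z^T]^T satisfies xi' = M xi + N d. *)
Definition closed_loop_M (R : realType) (p : plant R) (k : gains R) :
    'M[R]_(6 + 2) :=
  block_mx (plant_A p + plant_B p *m (gain_P k *m err_C k))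
           (plant_B p *m gain_I k)
           (err_C k) 0.

Definition closed_loop_N (R : realType) (p : plant R) : 'M[R]_(6 + 2, 2) :=
  col_mx (plant_E p) 0.

Lemma closed_loopE (R : realType) (p : plant R) (k : gains R)
    (x : 'cV[R]_6) (z d : 'cV[R]_2) :
  closed_loop_M p k *m col_mx x z + closed_loop_N p *m d
  = col_mx (plant_A p *m x
            + plant_B p *m (gain_P k *m (err_C k *m x) + gain_I k *m z)
            + plant_E p *m d)
           (err_C k *m x).
Proof.
rewrite mul_block_col mul_col_mx add_col_mx !mul0mx !addr0.
by rewrite mulmxDl mulmxDr !mulmxA -!addrA.
Qed.

Definition has_derivative (R : realType) (n : nat) (f : R -> 'cV[R]_n) (t : R)
    (v : 'cV[R]_n) : Prop :=
  forall i : 'I_n, is_derive t (1 : R) (fun s : R => f s i ord0) (v i ord0).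

Definition integral_from0 (R : realType) (e : R -> R) (t : R) : R :=
  \int[lebesgue_measure]_(s in `[0, t]) e s.

(* Trajectories live on [0, +oo[; the equations are required for t > 0, and the
   initial state is attached by continuity at 0. *)
Definition PI_trajectory (R : realType) (p : plant R) (k : gains R)
    (x V_W V_L y psi_W psi_L V_Lc psi_Lc : R -> R) : Prop :=
  let ex t := err_x k (x t) (V_W t) (V_L t) in
  let ey t := err_y k (y t) (psi_W t) (psi_L t) in
  let V_Wc t := Kxp k * ex t + KxI k * integral_from0 ex t in
  let psi_Wc t := Kyp k * ey t + KyI k * integral_from0 ey t in
  let state t := colv 6 [:: x t; V_W t; V_L t; y t; psi_W t; psi_L t] in
  (forall i : 'I_6,
     {within `[0, +oo[, continuous (fun t : R => state t i ord0)}) /\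
  (forall t : R, 0 < t ->
     has_derivative state t
       (plant_rhs p (x t) (V_W t) (V_L t) (y t) (psi_W t) (psi_L t)
          (V_Wc t) (psi_Wc t) (V_Lc t) (psi_Lc t))).

Definition augmented_state (R : realType) (k : gains R)
    (x V_W V_L y psi_W psi_L : R -> R) (t : R) : 'cV[R]_(6 + 2) :=
  col_mx
    (colv 6 [:: x t; V_W t; V_L t; y t; psi_W t; psi_L t])
    (colv 2 [:: integral_from0 (fun s => err_x k (x s) (V_W s) (V_L s)) t;
                integral_from0 (fun s => err_y k (y s) (psi_W s) (psi_L s)) t]).

(* [eigenvalue] only sees eigenvalues in the base field, so the real matrix is
   first mapped into the complex numbers R[i]. *)
Definition all_eigenvalues_in_open_left_half_plane (R : realType) (n : nat)
    (M : 'M[R]_n) : Prop :=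
  forall lambda : R[i],
    eigenvalue (map_mx (real_complex R) M) lambda -> complex.Re lambda < 0.

(* Main.v *)
Require Import Defs.
From mathcomp Require Import all_boot all_order all_algebra.
From mathcomp Require Import all_classical all_reals all_analysis.
From mathcomp Require Import complex.
From mathcomp Require Import ring lra.
Import Order.TTheory GRing.Theory Num.Theory numFieldNormedType.Exports.
Local Open Scope ring_scope.

(** The augmented state satisfies the stated equation because its first six
    rows are the plant equations, whose integral terms are the states z_x and
    z_y by definition, while its last two rows are the fundamental theorem of
    calculus for the errors e_x and e_y, which are continuous along a
    trajectory ([integral_from0_is_derive]).

    For the spectrum, left eigenvectors suit the triangular structure of the
    loop. No equation other than those of x, V_W and z_x involves x, V_W or z_x,
    so the x-, V_W- and z_x-components of a left eigenvector satisfy a closed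
    system. Once they vanish, so do the terms in y_r by which psi_W drives x,
    and the y-, psi_W- and z_y-components satisfy a closed system of the same
    form. Once these vanish too, there remain the V_L- and psi_L-components,
    whose eigenvalues are - 1 / tau_VL and - 1 / tau_psiL.

    Both closed systems are instances of [pi_channel_mode]: a first-order
    autopilot of time constant T in a proportional-integral loop, with
    characteristic polynomial

      T s^3 + (1 - b kp) s^2 - (b kI + a c kp) s - a c kI,

    where (a, b, c) = (-1, - KV, Kx) in the x-channel and
    (Vn, xr Ky - Kpsi, Ky) in the y-channel. The hypotheses on the gains say
    exactly that this cubic meets the Routh-Hurwitz conditions, which confine
    its roots to the open left half-plane ([cubic_roots_lt0]). *)

(** * Hurwitz cubics and single modes *)

Local Open Scope complex_scope.

(** If s = r + i w is a root with w <> 0, the imaginary part of the equation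
    gives a3 w^2 in terms of r, and eliminating w from the real part leaves

      8 a3^2 r^3 + 8 a2 a3 r^2 + 2 (a1 a3 + a2^2) r + (a1 a2 - a3 a0) = 0,

    which is impossible for r >= 0 since every coefficient is positive. *)
Lemma cubic_roots_lt0 (R : rcfType) (a3 a2 a1 a0 : R) (s : R[i]) :
  0 < a3 -> 0 < a2 -> 0 < a0 -> a3 * a0 / a2 < a1 ->
  a3%:C * s ^+ 3 + a2%:C * s ^+ 2 + a1%:C * s + a0%:C = 0 ->
  complex.Re s < 0.
Proof.
move=> a3_gt0 a2_gt0 a0_gt0; rewrite ltr_pdivrMr// => hurwitz.
have a1_gt0 : 0 < a1.
  by rewrite -(pmulr_lgt0 _ a2_gt0) (lt_trans _ hurwitz)// mulr_gt0.
case: s => r w /eqP; rewrite eq_complex /= => /andP[/eqP re0 /eqP im0].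
rewrite ltNge; apply/negP => r_ge0.
have [w0|w_neq0] := eqVneq w 0.
  have : 0 < a3 * r ^+ 3 + a2 * r ^+ 2 + a1 * r + a0.
    by rewrite ltr_wpDl// !addr_ge0 ?mulr_ge0 ?exprn_ge0// ltW.
  by move: re0; rewrite w0; lra.
have w2E : a3 * w ^+ 2 = 3 * a3 * r ^+ 2 + 2 * a2 * r + a1.
  by apply: (mulfI w_neq0); lra.
pose rePart := a3 * (r ^+ 3 - 3 * r * w ^+ 2) + a2 * (r ^+ 2 - w ^+ 2)
               + a1 * r + a0.
have rePart0 : rePart = 0 by rewrite /rePart; lra.
have : 0 < 8 * (a3 ^+ 2 * r ^+ 3 + a2 * a3 * r ^+ 2)
           + 2 * (a1 * a3 + a2 ^+ 2) * r + (a1 * a2 - a3 * a0).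
  rewrite ltr_wpDl ?subr_gt0//.
  by rewrite !(addr_ge0, mulr_ge0, exprn_ge0)// ltW.
suff -> : 8 * (a3 ^+ 2 * r ^+ 3 + a2 * a3 * r ^+ 2)
          + 2 * (a1 * a3 + a2 ^+ 2) * r + (a1 * a2 - a3 * a0) = 0.
  by rewrite ltxx.
transitivity (- (a3 * rePart) - (3 * a3 * r + a2) *
    (a3 * w ^+ 2 - (3 * a3 * r ^+ 2 + 2 * a2 * r + a1))).
  by rewrite /rePart; ring.
by rewrite rePart0 w2E subrr !mulr0 oppr0 addr0.
Qed.

(** In a left eigenvector for [s], the weights of a channel are [q] on the
    command, [d] on the position and [h] on the integrator, so that
    [kp * q + h] is the weight of the error.
    Multiplying the first equation by [s ^+ 2] and eliminating [d] and [h] makes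
    [q] a multiple of the characteristic cubic, so [q = 0] unless [s] is one of
    its roots. The case [s = 0] needs a separate argument to conclude
    [d = h = 0] from there: the equations for [d] and [h] then degenerate, and
    the nonzero constant term [a * c * kI] takes over. *)
Lemma pi_channel_mode (R : rcfType) (T a b c kp kI : R) (s q d h : R[i]) :
  0 < T -> 0 < 1 - b * kp -> 0 < - (a * c * kI) ->
  T * - (a * c * kI) / (1 - b * kp) < - (b * kI + a * c * kp) ->
  0 <= complex.Re s ->
  T%:C * s * q = - q + a%:C * d + b%:C * (kp%:C * q + h) ->
  s * d = c%:C * (kp%:C * q + h) ->
  s * h = kI%:C * q ->
  [/\ q = 0, d = 0 & h = 0].
Proof.
move=> T_gt0 a2_gt0 a0_gt0 hurwitz s_ge0 qE dE hE.
have ackI : a * c * kI != 0 by rewrite -oppr_eq0 gt_eqF.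
have q0 : q = 0.
  apply/eqP/negPn/negP => q_neq0; move: s_ge0; apply/negP; rewrite -ltNge.
  apply: (cubic_roots_lt0 _ _ _ _ _ _ T_gt0 a2_gt0 a0_gt0 hurwitz).
  apply: (mulfI q_neq0); rewrite mulr0.
  rewrite !rmorphN !rmorphD !rmorphN !rmorphM/= rmorph1.
  have -> : q * (T%:C * s ^+ 3 + (1 - b%:C * kp%:C) * s ^+ 2 +
     - (b%:C * kI%:C + a%:C * c%:C * kp%:C) * s - a%:C * c%:C * kI%:C) =
     s ^+ 2 * (T%:C * s * q) + s ^+ 2 * q
     - (b%:C * s + a%:C * c%:C) * (kp%:C * s * q + kI%:C * q) by ring.
  rewrite qE -hE.
  have -> : s ^+ 2 * (- q + a%:C * d + b%:C * (kp%:C * q + h)) =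
    - s ^+ 2 * q + a%:C * s * (s * d) + b%:C * s ^+ 2 * (kp%:C * q + h) by ring.
  by rewrite dE; ring.
have kI_neq0 : kI%:C != 0 :> R[i].
  by rewrite fmorph_eq0; apply: contraNneq ackI => ->; rewrite mulr0.
have c_neq0 : c%:C != 0 :> R[i].
  by rewrite fmorph_eq0; apply: contraNneq ackI => ->; rewrite mulr0 mul0r.
have a_neq0 : a%:C != 0 :> R[i].
  by rewrite fmorph_eq0; apply: contraNneq ackI => ->; rewrite !mul0r.
move: qE dE hE; rewrite q0 !mulr0 oppr0 !add0r => qE dE hE.
have [s0|s_neq0] := eqVneq s 0.
  move: dE; rewrite s0 mul0r => /esym/eqP; rewrite mulf_eq0 (negPf c_neq0)/=.
  move=> /eqP h0; split=> //; move/esym/eqP: qE.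
  by rewrite h0 mulr0 addr0 mulf_eq0 (negPf a_neq0) => /eqP.
have h0 : h = 0 by apply: (mulfI s_neq0); rewrite hE mulr0.
by split=> //; apply: (mulfI s_neq0); rewrite dE h0 !mulr0.
Qed.

(** This settles the V_L and psi_L equations of a left eigenvector once both
    channels have dropped out of them: the leader autopilots receive no
    feedback. *)
Lemma autopilot_mode (R : rcfType) (T : R) (s c : R[i]) :
  0 < T -> 0 <= complex.Re s -> - ((1 / T)%:C * c) = s * c -> c = 0.
Proof.
move=> T_gt0 s_ge0 /eqP; rewrite -mulNr -subr_eq0 -mulrBl mulf_eq0.
move=> /orP[|/eqP//]; rewrite subr_eq0 => /eqP sE; move: s_ge0.
by rewrite -sE/= leNgt oppr_lt0 div1r invr_gt0 T_gt0.
Qed.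

(** * Left eigenvectors of the closed loop *)

Local Notation cplx := (map_mx (real_complex _)).

Definition rowv (R : pzRingType) (n : nat) (s : seq R) : 'rV[R]_n :=
  \row_(i < n) s`_i.

Lemma rowv6P (R : pzRingType) (u : 'rV[R]_6) :
  exists a b c d e f, u = rowv R 6 [:: a; b; c; d; e; f].
Proof.
exists (u 0 (inord 0)), (u 0 (inord 1)), (u 0 (inord 2)),
  (u 0 (inord 3)), (u 0 (inord 4)), (u 0 (inord 5)).
by apply/rowP => -[[|[|[|[|[|[|//]]]]]] lti]; rewrite mxE /=; congr (u 0 _);
  apply/val_inj; rewrite /= inordK.
Qed.

Lemma rowv2P (R : pzRingType) (u : 'rV[R]_2) :
  exists g h, u = rowv R 2 [:: g; h].
Proof.
exists (u 0 (inord 0)), (u 0 (inord 1)).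
by apply/rowP => -[[|[|//]] lti]; rewrite mxE /=; congr (u 0 _);
  apply/val_inj; rewrite /= inordK.
Qed.

Lemma rowv_inj (R : pzRingType) n (s t : seq R) :
  rowv R n s = rowv R n t -> size s = n -> size t = n -> s = t.
Proof.
move=> eq_st ss st; apply: (@eq_from_nth _ 0); first by rewrite ss.
move=> i; rewrite ss => lt_in.
by have /rowP/(_ (Ordinal lt_in)) := eq_st; rewrite !mxE.
Qed.

Lemma rowv0 (R : pzRingType) n (s : seq R) : all (pred1 0) s -> rowv R n s = 0.
Proof.
move=> /all_nthP s0; apply/rowP => i; rewrite !mxE.
have [lt_is|le_si] := ltnP i (size s); last by rewrite nth_default.
exact/eqP/s0.
Qed.

Lemma rowvD (R : pzRingType) n (s t : seq R) : size s = size t ->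
  rowv R n s + rowv R n t = rowv R n [seq x.1 + x.2 | x <- zip s t].
Proof.
move=> st; apply/rowP => i; rewrite !mxE.
have [lt_is|le_si] := ltnP i (size s).
  by rewrite (nth_map (0, 0)) ?nth_zip// size_zip -st minnn.
by rewrite !nth_default ?addr0 ?size_map ?size_zip -?st ?minnn.
Qed.

Lemma rowvZ (R : pzRingType) n (a : R) (s : seq R) :
  a *: rowv R n s = rowv R n [seq a * x | x <- s].
Proof.
apply/rowP => i; rewrite !mxE.
have [lt_is|le_si] := ltnP i (size s); first by rewrite (nth_map 0).
by rewrite !nth_default ?mulr0 ?size_map.
Qed.

Lemma rowv_plant_A (R : realType) (p : plant R) (a b c d e f : R[i]) :
  rowv R[i] 6 [:: a; b; c; d; e; f] *m cplx (plant_A p) = rowv R[i] 6 [::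
    0;
    - a - (1 / tau_VW p)%:C * b;
    a - (1 / tau_VL p)%:C * c;
    0;
    (yr p / tau_psiW p)%:C * a + (Vn p - xr p / tau_psiW p)%:C * d
      - (1 / tau_psiW p)%:C * e;
    - (Vn p)%:C * d - (1 / tau_psiL p)%:C * f].
Proof.
apply/rowP => j; rewrite !mxE !big_ord_recl !big_ord0 !mxE.
by case: j => -[|[|[|[|[|[|//]]]]]] ? /=;
  rewrite ?rmorph0 ?rmorph1 ?rmorphN ?rmorph1; ring.
Qed.

Lemma rowv_plant_B (R : realType) (p : plant R) (a b c d e f : R[i]) :
  rowv R[i] 6 [:: a; b; c; d; e; f] *m cplx (plant_B p) = rowv R[i] 2 [::
    (1 / tau_VW p)%:C * b;
    - (yr p / tau_psiW p)%:C * a + (xr p / tau_psiW p)%:C * d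
      + (1 / tau_psiW p)%:C * e].
Proof.
apply/rowP => j; rewrite !mxE !big_ord_recl !big_ord0 !mxE.
by case: j => -[|[|//]] ? /=; rewrite ?rmorph0 ?rmorphN; ring.
Qed.

Lemma rowv_err_C (R : realType) (k : gains R) (r1 r2 : R[i]) :
  rowv R[i] 2 [:: r1; r2] *m cplx (err_C k) = rowv R[i] 6 [::
    (Kx k)%:C * r1; - (KV k)%:C * r1; (KV k)%:C * r1;
    (Ky k)%:C * r2; - (Kpsi k)%:C * r2; (Kpsi k)%:C * r2].
Proof.
apply/rowP => j; rewrite !mxE !big_ord_recl !big_ord0 !mxE.
by case: j => -[|[|[|[|[|[|//]]]]]] ? /=; rewrite ?rmorph0 ?rmorphN; ring.
Qed.

Lemma rowv_diag (R : rcfType) (q1 q2 : R[i]) (K1 K2 : R) :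
  rowv R[i] 2 [:: q1; q2] *m cplx (diag_mx (\row_(i < 2) [:: K1; K2]`_i))
  = rowv R[i] 2 [:: K1%:C * q1; K2%:C * q2].
Proof.
apply/rowP => j; rewrite map_diag_mx mul_mx_diag !mxE.
by case: j => -[|[|//]] ? /=; ring.
Qed.

(** In terms of [q], the weights of the two commands, and [r], the weights of
    the two errors, the eigenvector equations mention each gain once. *)
Lemma closed_loop_left_eigen (R : realType) (p : plant R) (k : gains R)
    (s : R[i]) (u : 'rV[R[i]]_6) (w : 'rV[R[i]]_2) :
  row_mx u w *m cplx (closed_loop_M p k) = s *: row_mx u w ->
  let q := u *m cplx (plant_B p) in
  let r := q *m cplx (gain_P k) + w in
  u *m cplx (plant_A p) + r *m cplx (err_C k) = s *: u /\
  q *m cplx (gain_I k) = s *: w.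
Proof.
rewrite map_block_mx mul_row_block scale_row_mx => /eq_row_mx[].
rewrite !map_mxD !map_mxM map_mx0 mulmx0 addr0 => uE wE q r.
by split; rewrite -?uE -?wE /r /q ?mulmxDr ?mulmxDl !mulmxA ?addrA.
Qed.

(** The x-channel alone determines its part of a left eigenvector; its vanishing
    removes the coupling through [yr], so that the y-channel can be treated
    next. *)
Lemma closed_loop_M_stable (R : realType) (p : plant R) (k : gains R)
  (tau_VW_gt0 : 0 < tau_VW p) (tau_VL_gt0 : 0 < tau_VL p)
  (tau_psiW_gt0 : 0 < tau_psiW p) (tau_psiL_gt0 : 0 < tau_psiL p)
  (Vn_gt0 : 0 < Vn p)
  (hx1 : Kxp k * KV k + 1 > 0)
  (hx2 : Kx k * KxI k > 0)
  (hx3 : Kxp k * Kx k + KV k * KxI k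
         > tau_VW p * Kx k * KxI k / (Kxp k * KV k + 1))
  (hy1 : Kyp k * Kpsi k - xr p * Ky k * Kyp k + 1 > 0)
  (hy2 : Ky k * KyI k < 0)
  (hy3 : KyI k * Kpsi k - Ky k * (Vn p * Kyp k + xr p * KyI k)
         > - (tau_psiW p * Vn p * Ky k * KyI k
              / (Kyp k * Kpsi k - xr p * Ky k * Kyp k + 1))) :
  all_eigenvalues_in_open_left_half_plane (closed_loop_M p k).
Proof.
move=> s /eigenvalueP[v].
have [a [b [c [d [e [f uE]]]]]] := rowv6P _ (lsubmx v).
have [g [h wE]] := rowv2P _ (rsubmx v).
have -> : v = row_mx (rowv _ 6 [:: a; b; c; d; e; f]) (rowv _ 2 [:: g; h]).
  by rewrite -uE -wE hsubmxK.
move=> /closed_loop_left_eigen[]; rewrite /gain_P /gain_I.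
rewrite rowv_plant_A rowv_plant_B !rowv_diag rowvD// rowv_err_C rowvD// !rowvZ.
move=> /rowv_inj/=/(_ erefl erefl)[]; rewrite !add0r.
move=> a_eq b_eq c_eq d_eq e_eq f_eq.
move=> /rowv_inj/=/(_ erefl erefl)[] g_eq h_eq v_neq0.
rewrite ltNge; apply: contra v_neq0 => s_ge0.
set q1 := (1 / tau_VW p)%:C * b in a_eq b_eq c_eq g_eq.
have tW (T : R) : 0 < T -> T%:C * (1 / T)%:C = 1 :> R[i].
  by move=> T_gt0; rewrite -rmorphM/= div1r divff ?rmorph1// gt_eqF.
have bE : b = (tau_VW p)%:C * q1 by rewrite mulrA tW// mul1r.
have [q10 a0 g0] : [/\ q1 = 0, a = 0 & g = 0].
  apply: (@pi_channel_mode _ (tau_VW p) (-1) (- KV k) (Kx k)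
            (Kxp k) (KxI k) s) => //.
  - by rewrite mulNr opprK addrC mulrC.
  - by rewrite !mulN1r mulNr opprK.
  - have -> : 1 - - KV k * Kxp k = Kxp k * KV k + 1 by ring.
    have -> : tau_VW p * - (-1 * Kx k * KxI k) = tau_VW p * Kx k * KxI k.
      by ring.
    have -> : - (- KV k * KxI k + -1 * Kx k * Kxp k) =
      Kxp k * Kx k + KV k * KxI k by ring.
    exact: hx3.
  - rewrite -mulrA [s * q1]mulrC mulrA -bE mulrC -b_eq !rmorphN rmorph1.
    by ring.
have b0 : b = 0 by rewrite bE q10 mulr0.
move: e_eq h_eq d_eq c_eq f_eq.
rewrite a0 b0 g0 q10 !(mulr0, add0r, oppr0, addr0).
move=> e_eq h_eq d_eq c_eq f_eq.
set q2 := (xr p / tau_psiW p)%:C * d + (1 / tau_psiW p)%:C * e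
  in e_eq h_eq d_eq f_eq.
(* Trading e for q2 turns the psi_W equation into the first-order lag that
   [pi_channel_mode] expects, and shifts the coefficients of the y-channel by
   the terms in xr. *)
have eE : e = (tau_psiW p)%:C * q2 - (xr p)%:C * d.
  rewrite mulrDr !mulrA tW// [xr p / _]mulrC -!rmorphM/= mulrA divff ?gt_eqF//.
  by rewrite !mul1r; ring.
have [q20 d0 h0] : [/\ q2 = 0, d = 0 & h = 0].
  apply: (@pi_channel_mode _ (tau_psiW p) (Vn p) (xr p * Ky k - Kpsi k) (Ky k)
            (Kyp k) (KyI k) s) => //.
  - have -> : 1 - (xr p * Ky k - Kpsi k) * Kyp k =
      Kyp k * Kpsi k - xr p * Ky k * Kyp k + 1 by ring.
    exact: hy1.
  - by rewrite -mulrA -mulrN mulr_gt0// oppr_gt0.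
  - have -> : 1 - (xr p * Ky k - Kpsi k) * Kyp k =
      Kyp k * Kpsi k - xr p * Ky k * Kyp k + 1 by ring.
    have -> : tau_psiW p * - (Vn p * Ky k * KyI k) =
      - (tau_psiW p * Vn p * Ky k * KyI k) by ring.
    have -> : - ((xr p * Ky k - Kpsi k) * KyI k + Vn p * Ky k * Kyp k) =
      KyI k * Kpsi k - Ky k * (Vn p * Kyp k + xr p * KyI k) by ring.
    by rewrite mulNr; exact: hy3.
  - have -> : (tau_psiW p)%:C * s * q2 = s * e + (xr p)%:C * (s * d).
      by rewrite eE; ring.
    by rewrite -e_eq -d_eq /q2 !div1r !(rmorphB, rmorphM)/=; ring.
have e0 : e = 0 by rewrite eE q20 d0 !mulr0 subr0.
move: c_eq f_eq; rewrite q20 d0 h0 !(mulr0, add0r, oppr0, addr0) => c_eq f_eq.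
have c0 := autopilot_mode _ _ _ _ tau_VL_gt0 s_ge0 c_eq.
have f0 := autopilot_mode _ _ _ _ tau_psiL_gt0 s_ge0 f_eq.
apply/eqP; rewrite c0 e0 f0.
by rewrite !rowv0 ?row_mx0//= eqxx.
Qed.

(** * The equation of the augmented state *)

Local Close Scope complex_scope.
Local Open Scope classical_set_scope.

Lemma integral_from0_is_derive (R : realType) (e : R -> R) (t : R) :
  {within `[0, +oo[, continuous e} -> 0 < t ->
  is_derive t (1 : R) (integral_from0 e) (e t).
Proof.
move=> ce t_gt0.
have ce1 : {within `[0, t + 1], continuous e}.
  by apply: continuous_subspaceW ce; apply: subset_itvl; rewrite bnd_simp.
have inte : lebesgue_measure.-integrable `[0, t + 1] (EFin \o e).
  by apply: continuous_compact_integrable => //; exact: segment_compact.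
have cet : {for t, continuous e}.
  by have /continuous_within_itvcyP[+ _] := ce; apply; rewrite in_itv/= t_gt0.
have t_lt : t < t + 1 by rewrite ltrDl.
have [der dE] := continuous_FTC1 t_lt inte t_gt0 cet.
by apply: DeriveDef; [exact: der|rewrite -dE derive1E].
Qed.

Lemma has_derivative_col_mx (R : realType) (m n : nat) (f : R -> 'cV[R]_m)
    (g : R -> 'cV[R]_n) (t : R) (v : 'cV[R]_m) (w : 'cV[R]_n) :
  has_derivative f t v -> has_derivative g t w ->
  has_derivative (fun s => col_mx (f s) (g s)) t (col_mx v w).
Proof.
move=> df dg i; rewrite -(fintype.splitK i); case: (fintype.split i) => j /=.
- rewrite col_mxEu (_ : (fun s => _) = (fun s => f s j ord0)); first exact: df.
  by apply/funext => s; rewrite col_mxEu.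
- rewrite col_mxEd (_ : (fun s => _) = (fun s => g s j ord0)); first exact: dg.
  by apply/funext => s; rewrite col_mxEd.
Qed.

Lemma pi_lawE (R : realType) (k : gains R) (ex ey zx zy : R) :
  gain_P k *m colv 2 [:: ex; ey] + gain_I k *m colv 2 [:: zx; zy]
  = colv 2 [:: Kxp k * ex + KxI k * zx; Kyp k * ey + KyI k * zy].
Proof.
apply/matrixP => i j; rewrite !mul_diag_mx !mxE.
by case: i => -[|[|//]] ?.
Qed.

Lemma within_continuous_lin3 (R : realType) (A : set R) (f g h : R -> R)
    (a b : R) :
  {within A, continuous f} -> {within A, continuous g} ->
  {within A, continuous h} ->
  {within A, continuous (fun t => a * f t + b * (h t - g t))}.
Proof.
move=> cf cg ch t.
apply: cvgD; first by apply: cvgM; [exact: cvg_cst|exact: cf].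
by apply: cvgM; [exact: cvg_cst|apply: cvgB; [exact: ch|exact: cg]].
Qed.

Lemma augmented_state_has_derivative (R : realType) (p : plant R) (k : gains R)
    (x V_W V_L y psi_W psi_L V_Lc psi_Lc : R -> R) (t : R) :
  PI_trajectory p k x V_W V_L y psi_W psi_L V_Lc psi_Lc -> 0 < t ->
  has_derivative (augmented_state k x V_W V_L y psi_W psi_L) t
    (closed_loop_M p k *m augmented_state k x V_W V_L y psi_W psi_L t
     + closed_loop_N p *m colv 2 [:: V_Lc t; psi_Lc t]).
Proof.
move=> [cont der] t_gt0.
have comp i (lti : (i < 6)%N) : {within `[0, +oo[, continuous
    (fun t => [:: x t; V_W t; V_L t; y t; psi_W t; psi_L t]`_i)}.
  rewrite (_ : (fun t => _) = fun t => colv 6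
    [:: x t; V_W t; V_L t; y t; psi_W t; psi_L t] (Ordinal lti) ord0).
    exact: cont.
  by apply/funext => s; rewrite mxE.
rewrite {2}/augmented_state closed_loopE -err_CE pi_lawE -plant_rhsE.
apply: has_derivative_col_mx; first exact: der.
move=> [[|[|//]] lti]; rewrite mxE/=.
- rewrite (_ : (fun s => _) =
    integral_from0 (fun s => err_x k (x s) (V_W s) (V_L s))).
    apply: integral_from0_is_derive => //; apply: within_continuous_lin3.
    + exact: (comp 0%N).
    + exact: (comp 1%N).
    + exact: (comp 2%N).
  by apply/funext => s; rewrite mxE.
- rewrite (_ : (fun s => _) =
    integral_from0 (fun s => err_y k (y s) (psi_W s) (psi_L s))).
    apply: integral_from0_is_derive => //; apply: within_continuous_lin3.
    + exact: (comp 3%N).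
    + exact: (comp 4%N).
    + exact: (comp 5%N).
  by apply/funext => s; rewrite mxE.
Qed.

Local Close Scope classical_set_scope.

Theorem theorem1 (R : realType) (p : plant R) (k : gains R)
  (tau_VW_gt0 : 0 < tau_VW p) (tau_VL_gt0 : 0 < tau_VL p)
  (tau_psiW_gt0 : 0 < tau_psiW p) (tau_psiL_gt0 : 0 < tau_psiL p)
  (Vn_gt0 : 0 < Vn p)
  (hx1 : Kxp k * KV k + 1 > 0)
  (hx2 : Kx k * KxI k > 0)
  (hx3 : Kxp k * Kx k + KV k * KxI k
         > tau_VW p * Kx k * KxI k / (Kxp k * KV k + 1))
  (hy1 : Kyp k * Kpsi k - xr p * Ky k * Kyp k + 1 > 0)
  (hy2 : Ky k * KyI k < 0)
  (hy3 : KyI k * Kpsi k - Ky k * (Vn p * Kyp k + xr p * KyI k)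
         > - (tau_psiW p * Vn p * Ky k * KyI k
              / (Kyp k * Kpsi k - xr p * Ky k * Kyp k + 1))) :
  (forall x V_W V_L y psi_W psi_L V_Lc psi_Lc : R -> R,
     PI_trajectory p k x V_W V_L y psi_W psi_L V_Lc psi_Lc ->
     forall t : R, 0 < t ->
       has_derivative (augmented_state k x V_W V_L y psi_W psi_L) t
         (closed_loop_M p k *m augmented_state k x V_W V_L y psi_W psi_L t
          + closed_loop_N p *m colv 2 [:: V_Lc t; psi_Lc t])) /\
  all_eigenvalues_in_open_left_half_plane (closed_loop_M p k).
Proof.
split; last exact: closed_loop_M_stable.
by move=> x V_W V_L y psi_W psi_L V_Lc psi_Lc traj t;
  exact: augmented_state_has_derivative.
Qed.
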